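(* Let $R_q(k,s)$ be the number of solutions $(Y_1,Z_1,U_1,V_1,\ldots,Y_q,Z_q,U_q,V_q)$ in $\mathbb{F}_2[T]$ of \[\begin{cases} Y_1Z_1+\cdots+Y_qZ_q=0,\\ Y_1U_1+\cdots+Y_qU_q=0,\\ Y_1V_1+\cdots+Y_qV_q=0,\end{cases}\] with $\deg Y_i\leq k-1$, $\deg Z_i\leq s-1$, $\deg U_i\leq s-1$, $\deg V_i\leq s-1$ for $1\leq i\leq q$. Then $$R_q(k,s) = \int_{\mathbb{P}\times\mathbb{P}\times\mathbb{P}} g_{k,s}^{q}(t,\eta,\xi)\,dt\,d\eta\,d\xi = 2^{(3s+k)q}\cdot 2^{-3k-3s+3}\cdot\sum_{i=0}^{\inf(3s,k)}\Gamma_{i}^{\left[s\atop{s\atop s}\right]\times k}\cdot 2^{-qi}.$$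
   Context: $\mathbb{K}=\mathbb{F}_2((T^{-1}))$, $\mathbb{P}$ its unit interval with normalized Haar measure, $E$ the additive character of $\mathbb{K}$ ($E(\sum a_iT^i)=(-1)^{a_{-1}}$), and $g_{k,s}(t,\eta,\xi)=\sum_{\deg Y\leq k-1}\sum_{\deg Z\leq s-1}E(tYZ)\sum_{\deg U\leq s-1}E(\eta YU)\sum_{\deg V\leq s-1}E(\xi YV)$. $\Gamma_{i}^{\left[s\atop{s\atop s}\right]\times k}$ is the number of rank $i$ matrices $\left[\frac{A}{\frac{B}{C}}\right]$ over $\mathbb{F}_2$ with $A,B,C$ all $s\times k$ persymmetric matrices. *)

(* Defs.v *)
From HB Require Import structures.
From mathcomp Require Import all_boot all_order all_algebra.
From mathcomp Require Import all_classical all_reals all_analysis.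
From mathcomp Require Import zify.

Set Implicit Arguments.
Unset Strict Implicit.
Unset Printing Implicit Defensive.

Import Order.TTheory GRing.Theory Num.Theory.
Local Open Scope classical_set_scope.
Local Open Scope ring_scope.

(* The formal series sum_i a_i T^i, i in Z, whose degree is at most n. *)
Definition deg_le (a : int -> 'F_2) (n : int) : Prop :=
  forall i, n < i -> a i = 0.

(* F_2((T^-1)): a series may have infinitely many negative powers of T, but
   only finitely many positive ones. *)
Record laurent := Laurent {
  lcoef :> int -> 'F_2;
  laurentP : exists n, deg_le lcoef n }.

Lemma laurent_ext (x y : laurent) : (forall i, x i = y i) -> x = y.
Proof.
case: x y => [a ha] [b hb] /= /funext ab.
by move: ha hb; rewrite ab => ha hb; rewrite (Prop_irrelevance ha hb).
Qed.

HB.instance Definition _ := gen_eqMixin laurent.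
HB.instance Definition _ := gen_choiceMixin laurent.

Fact zerol_subproof : exists n, deg_le (fun=> 0) n.
Proof. by exists 0. Qed.
Definition zerol := Laurent zerol_subproof.

Fact onel_subproof : exists n, deg_le (fun i => (i == 0)%:R) n.
Proof. by exists 0 => i i0; rewrite gt_eqF. Qed.
Definition onel := Laurent onel_subproof.

Fact addl_subproof (x y : laurent) : exists n, deg_le (fun i => x i + y i) n.
Proof.
have [[n xn] [m ym]] := (laurentP x, laurentP y).
by exists (Num.max n m) => i; rewrite gt_max => /andP[/xn-> /ym->]; rewrite addr0.
Qed.
Definition addl x y := Laurent (addl_subproof x y).

Fact oppl_subproof (x : laurent) : exists n, deg_le (fun i => - x i) n.
Proof. by have [n xn] := laurentP x; exists n => i /xn->; rewrite oppr0. Qed.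
Definition oppl x := Laurent (oppl_subproof x).

(* The sum has finitely many nonzero terms, as x and y have bounded degree. *)
Definition convl (x y : int -> 'F_2) (n : int) : 'F_2 :=
  \sum_(i \in [set: int]) x i * y (n - i).

Fact mull_subproof (x y : laurent) : exists n, deg_le (convl x y) n.
Proof.
have [[n xn] [m ym]] := (laurentP x, laurentP y).
exists (n + m) => i nmi; apply: fsbig1 => j _.
have [/xn->|jn] := ltP n j; first by rewrite mul0r.
by rewrite ym ?mulr0 //; lia.
Qed.
Definition mull x y := Laurent (mull_subproof x y).

Lemma finite_itv_int (m M : int) : finite_set [set i : int | m <= i <= M].
Proof.
apply: (@sub_finite_set _ _ ((fun k : nat => m + k%:Z) @` `I_(absz (M - m)).+1)).
  move=> i /= miM; exists (absz (i - m)); lia.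
exact/finite_image/finite_II.
Qed.

Lemma fsum_itv_int (F : int -> 'F_2) (m M : int) :
  (forall i, F i != 0 -> m <= i <= M) ->
  \sum_(i \in [set: int]) F i = \sum_(i \in [set i | m <= i <= M]) F i.
Proof.
move=> Fm; apply/esym/fsbig_widen => // i /= [_ /negP imM].
by apply/eqP; apply: contraNT imM => /Fm.
Qed.

Lemma addlA : associative addl.
Proof. by move=> x y z; apply: laurent_ext => i /=; rewrite addrA. Qed.
Lemma addlC : commutative addl.
Proof. by move=> x y; apply: laurent_ext => i /=; rewrite addrC. Qed.
Lemma add0l : left_id zerol addl.
Proof. by move=> x; apply: laurent_ext => i /=; rewrite add0r. Qed.
Lemma addNl : left_inverse zerol oppl addl.
Proof. by move=> x; apply: laurent_ext => i /=; rewrite addNr. Qed.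

HB.instance Definition _ := GRing.isZmodule.Build laurent addlA addlC add0l addNl.

Lemma convl_itv (x y : int -> 'F_2) a b n m M : deg_le x a -> deg_le y b ->
  m <= n - b -> a <= M ->
  convl x y n = \sum_(i \in [set i | m <= i <= M]) x i * y (n - i).
Proof.
move=> xa yb hm hM; apply: fsum_itv_int => i; apply: contra_neqT => imM.
have [/xa->|ia] := ltP a i; first by rewrite mul0r.
by rewrite yb ?mulr0 //; lia.
Qed.

Lemma mullC : commutative mull.
Proof.
move=> x y; apply: laurent_ext => n /=; rewrite /convl.
rewrite (reindex_fsbigT (fun i : int => n - i)) /=.
  by apply: eq_fsbigr => i _; rewrite mulrC subKr.
by exists (fun i : int => n - i) => i; lia.
Qed.

Lemma mul1l : left_id onel mull.
Proof.
move=> x; apply: laurent_ext => n /=; rewrite /convl.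
have -> : (\sum_(i \in [set: int]) (i == 0)%:R * x (n - i) =
  \sum_(i \in [set (0 : int)]) (i == 0)%:R * x (n - i) :> 'F_2)%R.
  apply/esym/fsbig_widen => // i /= [_ /eqP i0].
  by rewrite (negbTE i0) mul0r.
by rewrite fsbig_set1 eqxx mul1r subr0.
Qed.

Lemma mullDl : left_distributive mull addl.
Proof.
move=> x y z; apply: laurent_ext => n /=.
have [[a xa] [b yb]] := (laurentP x, laurentP y); have [c zc] := laurentP z.
have xyab : deg_le (addl x y) (Num.max a b).
  by move=> i; rewrite gt_max /= => /andP[/xa-> /yb->]; rewrite addr0.
rewrite (convl_itv (m := n - c) (M := Num.max a b) xyab zc) //.
rewrite (convl_itv (m := n - c) (M := Num.max a b) xa zc) ?le_max ?lexx //.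
rewrite (convl_itv (m := n - c) (M := Num.max a b) yb zc) ?le_max ?lexx ?orbT //.
rewrite -fsbig_split /=; last exact: finite_itv_int.
by apply: eq_fsbigr => i _; rewrite mulrDl.
Qed.

Lemma mullA : associative mull.
Proof.
move=> x y z; apply: laurent_ext => n /=.
have [[a xa] [b yb]] := (laurentP x, laurentP y); have [c zc] := laurentP z.
have yzbc : deg_le (convl y z) (b + c).
  move=> i bci; apply: fsbig1 => j _.
  have [/yb->|jb] := ltP b j; first by rewrite mul0r.
  by rewrite zc ?mulr0 //; lia.
have xyab : deg_le (convl x y) (a + b).
  move=> i bci; apply: fsbig1 => j _.
  have [/xa->|jb] := ltP a j; first by rewrite mul0r.
  by rewrite yb ?mulr0 //; lia.
rewrite (convl_itv (m := n - b - c) (M := a) xa yzbc) //; last by lia.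
rewrite (convl_itv (m := n - c) (M := a + b) xyab zc) //.
transitivity (\sum_(j \in [set j | n - b - c <= j <= a])
  \sum_(i \in [set i | n - c <= i <= a + b]) x j * (y (i - j) * z (n - i)) : 'F_2).
  apply: eq_fsbigr => j; rewrite inE /= => /andP[_ ja].
  rewrite -mulr_fsumr; congr (_ * _).
  rewrite /convl (reindex_fsbigT (fun i : int => i - j)) /=; last first.
    by exists (fun i : int => i + j) => i; lia.
  rewrite (@fsum_itv_int _ (n - c) (a + b)) => [|i].
    by apply: eq_fsbigr => i _; congr (_ * z _); lia.
  apply: contra_neqT => imM.
  have [/yb->|ib] := ltP b (i - j); first by rewrite mul0r.
  by rewrite zc ?mulr0 //; lia.
rewrite exchange_fsbig; [|exact: finite_itv_int..].
apply: eq_fsbigr => i; rewrite inE /= => /andP[ni _].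
rewrite (convl_itv (m := n - b - c) (M := a) xa yb) //; last by lia.
by rewrite mulr_fsuml; apply: eq_fsbigr => j _; rewrite mulrA.
Qed.

Lemma onel_neq0 : onel != 0 :> laurent.
Proof. by apply/eqP => /(congr1 (fun x : laurent => x 0)) /eqP. Qed.

HB.instance Definition _ :=
  GRing.Zmodule_isComNzRing.Build laurent mullA mullC mul1l mullDl onel_neq0.

Fact laurent_of_poly_subproof (p : {poly 'F_2}) :
  exists n, deg_le (fun i => if i is Posz j then p`_j else 0) n.
Proof.
exists (size p)%:Z => -[j|//] pj.
by rewrite nth_default // ltnW // -ltz_nat.
Qed.
Definition laurent_of_poly (p : {poly 'F_2}) := Laurent (laurent_of_poly_subproof p).

Notation "p %:L" := (laurent_of_poly p) (at level 2, format "p %:L") : ring_scope.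

(* The topology of the absolute value |x| = 2 ^ deg x; the balls centered at x
   are the sets of the y such that deg (y - x) <= n. *)
Definition laurent_open (U : set laurent) : Prop :=
  forall x, U x -> exists n, forall y : laurent, deg_le (y - x) n -> U y.

Lemma laurent_openT : laurent_open setT.
Proof. by move=> x _; exists 0. Qed.

Lemma laurent_openI U V : laurent_open U -> laurent_open V -> laurent_open (U `&` V).
Proof.
move=> oU oV x [/oU[n Un] /oV[m Vm]]; exists (Num.min n m) => y yx.
by split; [apply: Un|apply: Vm] => i ni; apply: yx; rewrite gt_min ni ?orbT.
Qed.

Lemma laurent_open_bigU (I : Type) (f : I -> set laurent) :
  (forall i, laurent_open (f i)) -> laurent_open (\bigcup_i f i).
Proof. by move=> of_ x [i _ /of_[n fn]]; exists n => y /fn; exists i. Qed.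

HB.instance Definition _ := isPointed.Build laurent 0.
HB.instance Definition _ := isOpenTopological.Build laurent
  laurent_openT laurent_openI laurent_open_bigU.

HB.instance Definition _ := @isMeasurable.Build (sigma_display (@open laurent)) laurent
  <<s (@open laurent) >> (@sigma_algebra0 _ setT (@open laurent))
  (@sigma_algebraC _ (@open laurent)) (@sigma_algebra_bigcup _ setT (@open laurent)).

(* |x| < 1 *)
Definition unit_itv : set laurent := [set x : laurent | deg_le x (-1)].

Section haar.
Variable R : realType.

Definition normalized_haar (mu : set laurent -> \bar R) : Prop :=
  (forall (x : laurent) (A : set laurent), measurable A ->
     mu ((fun y => x + y) @` A) = mu A) /\ mu unit_itv = 1%E.

Definition charE (x : laurent) : R := (-1) ^+ (x (-1) : nat).

Definition g (k s : nat) (t eta xi : laurent) : R :=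
  \sum_(Y : {poly_k 'F_2}) \sum_(Z : {poly_s 'F_2}) charE (t * Y%:L * Z%:L) *
    (\sum_(U : {poly_s 'F_2}) charE (eta * Y%:L * U%:L) *
      (\sum_(V : {poly_s 'F_2}) charE (xi * Y%:L * V%:L))).

End haar.

(* Constant along antidiagonals (Hankel). *)
Definition persymmetric (m n : nat) (A : 'M['F_2]_(m, n)) : bool :=
  [forall i : 'I_m, forall j : 'I_n, forall i' : 'I_m, forall j' : 'I_n,
    (i + j == i' + j')%N ==> (A i j == A i' j')].

(* The three s x k blocks of M, from top to bottom, are usubmx M,
   usubmx (dsubmx M) and dsubmx (dsubmx M). *)
Definition Gamma (s k i : nat) : nat :=
  #|[pred M : 'M['F_2]_(s + (s + s), k) |
      [&& persymmetric (usubmx M), persymmetric (usubmx (dsubmx M)),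
          persymmetric (dsubmx (dsubmx M)) & \rank M == i]]|.

(* {poly_n 'F_2} is the type of the polynomials of degree at most n - 1,
   0 included. *)
Definition num_solutions (q k s : nat) : nat :=
  #|[pred x : {ffun 'I_q -> {poly_k 'F_2}} * {ffun 'I_q -> {poly_s 'F_2}} *
              {ffun 'I_q -> {poly_s 'F_2}} * {ffun 'I_q -> {poly_s 'F_2}} |
      let: (Y, Z, U, V) := x in
      [&& \sum_i (Y i : {poly 'F_2}) * Z i == 0,
          \sum_i (Y i : {poly 'F_2}) * U i == 0 &
          \sum_i (Y i : {poly 'F_2}) * V i == 0]]|.

(* Main.v *)
(** Both equalities compare with a finite sum over triples (a, b, c) of sequences of
    N = k + s - 1 elements of F_2.  As deg (YZ) <= N - 1, the value of g at (t, eta, xi)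
    depends only on the first N negative coefficients of t, eta and xi, so g is constant
    on products of cylinders of measure 2^-N (by translation invariance), and the
    integral of g^q is 2^(-3N) times the sum of its values.
    - Summing over Z, U, V first, g equals 2^(3s) times the number of Y killed by the
      three stacked s x k Hankel matrices M of a, b, c, that is 2^(3s + k - rank M);
      grouping the triples by rank M gives the sum over Gamma.
    - Expanding the q-th power and summing over (a, b, c) first, orthogonality of
      characters leaves the solutions of the system, each with weight 2^(3N). *)

Require Import Defs.
From HB Require Import structures.
From mathcomp Require Import all_boot all_order all_algebra.
From mathcomp Require Import mxabelem.
From mathcomp Require Import all_classical all_reals all_analysis.
From mathcomp Require Import measurable_realfun zify ring.
Import Order.TTheory GRing.Theory Num.Theory.
Local Open Scope classical_set_scope.
Local Open Scope ring_scope.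

(** * Character sums over F_2 *)

Lemma F2E (x : 'F_2) : x = (x != 0)%:R.
Proof. by apply: val_inj; case: x => -[|[|]]. Qed.

Section character.
Variable R : realType.

Definition sgn2 (x : 'F_2) : R := (-1) ^+ (x : nat).

Lemma sgn2_0 : sgn2 0 = 1. Proof. by []. Qed.

(** Only the parity of an exponent of -1 matters, and addition in ['F_2] is addition of naturals
    modulo 2. *)
Lemma sgn2D (x y : 'F_2) : sgn2 (x + y) = sgn2 x * sgn2 y.
Proof. by rewrite /sgn2 -exprD -signr_odd -[RHS]signr_odd /= odd_mod. Qed.

Lemma sgn2_sum (I : Type) (r : seq I) (P : pred I) (F : I -> 'F_2) :
  sgn2 (\sum_(i <- r | P i) F i) = \prod_(i <- r | P i) sgn2 (F i).
Proof. exact: (big_morph _ sgn2D sgn2_0). Qed.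

Lemma sum_sgn2 (w : 'F_2) : \sum_(x : 'F_2) sgn2 (x * w) = 2 * (w == 0)%:R.
Proof.
rewrite big_ord_recl big_ord1 (F2E w) /sgn2.
by case: (w == 0) => /=; rewrite ?mulr1 ?mulr0 ?expr0 ?expr1 ?subrr.
Qed.

(** Parametrizing Z by its coefficients turns the sum into a product over j of sums over F_2, each
    equal to 2 or 0. *)
Lemma sum_npoly_sgn2 (n : nat) (w : 'I_n -> 'F_2) :
  \sum_(Z : {poly_n 'F_2}) sgn2 (\sum_(j < n) Z`_j * w j) =
  2 ^+ n * [forall j, w j == 0]%:R.
Proof.
pose h (f : {ffun 'I_n -> 'F_2}) : {poly_n 'F_2} := rVnpoly (\row_j f j).
pose h' (Z : {poly_n 'F_2}) : {ffun 'I_n -> 'F_2} := [ffun j => npoly_rV Z 0 j].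
have hK : cancel h h'.
  by move=> f; apply/ffunP => j; rewrite ffunE /h rVnpolyK mxE.
have h'K : cancel h' h.
  move=> Z; rewrite /h -[RHS]npoly_rV_K; congr rVnpoly.
  by apply/rowP => j; rewrite !mxE ffunE mxE.
rewrite (reindex h); last by exists h' => ? _.
under eq_bigr => f _.
  rewrite sgn2_sum; under eq_bigr => j _.
    have -> : (h f)`_j = f j by rewrite -[in RHS](hK f) ffunE mxE.
    over.
  over.
rewrite -(bigA_distr_bigA (fun j x => sgn2 (x * w j))) /=.
under eq_bigr do rewrite sum_sgn2.
rewrite big_split /= prodr_const card_ord; congr (_ * _).
have [/forallP w0|/forallPn[j wj]] := boolP [forall j, w j == 0].
  by rewrite big1 // => j _; rewrite w0.
by rewrite (bigD1 j) //= (negbTE wj) mul0r.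
Qed.

End character.
Arguments sgn2 {R}.

(** * Pairing of sequences with polynomials, Hankel matrices *)

(* The coefficient of T^-1 in t P is [dualp n a P], where a_l is the coefficient of
   T^(-1-l) in t and deg P < n. *)
Definition dualp (n : nat) (a : nat -> 'F_2) (P : {poly 'F_2}) : 'F_2 :=
  \sum_(l < n) P`_l * a l.

Lemma dualpD n a : {morph dualp n a : P Q / P + Q}.
Proof.
by move=> P Q; rewrite /dualp -big_split; apply: eq_bigr => l _; rewrite coefD mulrDl.
Qed.

Lemma dualp0 n a : dualp n a 0 = 0.
Proof. by rewrite /dualp big1 // => l _; rewrite coef0 mul0r. Qed.

Lemma dualpZXn n a c m : (m < n)%N -> dualp n a (c *: 'X^m) = c * a m.
Proof.
move=> mn; rewrite /dualp (bigD1 (Ordinal mn)) //= coefZ coefXn eqxx mulr1.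
rewrite big1 ?addr0 // => l /negbTE lm.
by rewrite coefZ coefXn (lm : (l == m :> nat) = false) mulr0 mul0r.
Qed.

(** In monomial bases the form pairs X^i and X^j to [a (i + j)]: its matrix is Hankel. Since i < k
    and j < s, i + j is less than [(k + s).-1], so no term is truncated. *)
Lemma dualpM (k s : nat) a (Y : {poly_k 'F_2}) (Z : {poly_s 'F_2}) :
  dualp (k + s).-1 a ((Y : {poly 'F_2}) * Z) = \sum_(j < s) Z`_j * \sum_(i < k) a (j + i)%N * Y`_i.
Proof.
have npolyE n (P : {poly_n 'F_2}) : P = \sum_(i < n) P`_i *: 'X^i :> {poly _}.
  by rewrite -[LHS](@coefK _ P) -[RHS]poly_def; apply/polyP => i;
    rewrite !coef_poly; case: ltnP => [ip|]; case: ltnP => // ni;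
    [rewrite big_coef_npoly|move=> ?; rewrite nth_default].
have dual_sum (I : finType) (F : I -> {poly 'F_2}) :
    dualp (k + s).-1 a (\sum_i F i) = \sum_i dualp (k + s).-1 a (F i).
  exact: (big_morph _ (dualpD _ _) (dualp0 _ _)).
rewrite {1}(npolyE _ Y) {1}(npolyE _ Z) big_distrlr /= exchange_big dual_sum.
apply: eq_bigr => j _; rewrite dual_sum mulr_sumr; apply: eq_bigr => i _.
rewrite -scalerAl -scalerAr scalerA -exprD dualpZXn.
  by rewrite [(i + j)%N]addnC; ring.
by have := ltn_ord i; have := ltn_ord j; lia.
Qed.

Lemma coef_mul_poly (x : laurent) (P : {poly 'F_2}) (m : nat) (n : int) :
  (size P <= m)%N -> (x * P%:L) n = \sum_(j < m) x (n - j%:Z) * P`_j.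
Proof.
move=> sP; rewrite -[x * P%:L]/(mull x P%:L) /= /convl.
(* The convolution is supported on these indices: elsewhere n - i is negative or at least the size
   of P. *)
pose r := [seq n - j%:Z | j : nat <- iota 0 m].
rewrite -(@fsbig_widen _ _ _ _ [set` r]) => [||i /= [_ ir]] //.
  rewrite -fsbig_seq; last by rewrite map_inj_uniq ?iota_uniq // => i j; lia.
  rewrite big_map -[X in iota 0 X]subn0 -/(index_iota 0 m) big_mkord.
  by apply: eq_bigr => j _; rewrite subKr.
case E : (n - i) => [j|j]; last by rewrite mulr0.
rewrite nth_default ?mulr0 //; apply: (leq_trans sP); rewrite leqNgt.
apply/negP => jm; apply: ir; apply/mapP; exists j; first by rewrite mem_iota.
by lia.
Qed.

Definition neg_coef (t : laurent) (l : nat) : 'F_2 := t (-1 - l%:Z).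

Definition hankel (s k : nat) (a : nat -> 'F_2) : 'M['F_2]_(s, k) :=
  \matrix_(i, j) a (i + j)%N.

Definition hankel3 (s k : nat) (a b c : nat -> 'F_2) : 'M['F_2]_(s + (s + s), k) :=
  col_mx (hankel s k a) (col_mx (hankel s k b) (hankel s k c)).

(** [kermx] is a left kernel, hence the transposes; [rowg] lists the vectors of a row space, here
    one of dimension k - rank M. *)
Lemma card_npoly_kernel (m k : nat) (M : 'M['F_2]_(m, k)) :
  #|[pred Y : {poly_k 'F_2} | M *m (npoly_rV Y)^T == 0]| = (2 ^ (k - \rank M))%N.
Proof.
transitivity #|rowg (kermx M^T)|; last first.
  by rewrite card_rowg card_Fp // mxrank_ker mxrank_tr.
rewrite -(card_imset _ (can_inj (@npoly_rV_K 'F_2 k))); apply: eq_card => v.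
rewrite inE; apply/imsetP/idP => [[Y]|].
  rewrite inE => /eqP MY ->; apply/sub_kermxP.
  by rewrite -[npoly_rV Y]trmxK -trmx_mul MY trmx0.
move=> /sub_kermxP vM; exists (rVnpoly v); rewrite ?rVnpolyK //.
by rewrite inE rVnpolyK -[M]trmxK -trmx_mul vM trmx0.
Qed.

(** * Values of g and ranks of Hankel matrices *)

Section gcoef.
Variables (R : realType) (k s : nat).

(* [g], as a function of the coefficients of T^-1, T^-2, ... in t, eta and xi. *)
Definition gcoef (a b c : nat -> 'F_2) : R :=
  \sum_(Y : {poly_k 'F_2}) \sum_(Z : {poly_s 'F_2}) sgn2 (dualp (k + s).-1 a ((Y : {poly 'F_2}) * Z)) *
    (\sum_(U : {poly_s 'F_2}) sgn2 (dualp (k + s).-1 b ((Y : {poly 'F_2}) * U)) *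
      (\sum_(V : {poly_s 'F_2}) sgn2 (dualp (k + s).-1 c ((Y : {poly 'F_2}) * V)))).

Lemma charE_mul_poly (t : laurent) (Y : {poly_k 'F_2}) (Z : {poly_s 'F_2}) :
  charE R (t * Y%:L * Z%:L) = sgn2 (dualp (k + s).-1 (neg_coef t) ((Y : {poly 'F_2}) * Z)).
Proof.
congr ((-1) ^+ nat_of_ord _); rewrite dualpM (coef_mul_poly _ _ s) ?size_npoly //.
apply: eq_bigr => j _; rewrite mulrC (coef_mul_poly _ _ k) ?size_npoly //.
by congr (_ * _); apply: eq_bigr => i _; congr (t _ * _); lia.
Qed.

Lemma g_gcoef (t eta xi : laurent) :
  g R k s t eta xi = gcoef (neg_coef t) (neg_coef eta) (neg_coef xi).
Proof.
apply: eq_bigr => Y _; apply: eq_bigr => Z _; rewrite charE_mul_poly; congr (_ * _).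
apply: eq_bigr => U _; rewrite charE_mul_poly; congr (_ * _).
by apply: eq_bigr => V _; rewrite charE_mul_poly.
Qed.

(** This makes g constant on products of cylinders. *)
Lemma eq_gcoef (a b c a' b' c' : nat -> 'F_2) :
  (forall l, (l < (k + s).-1)%N -> a l = a' l) ->
  (forall l, (l < (k + s).-1)%N -> b l = b' l) ->
  (forall l, (l < (k + s).-1)%N -> c l = c' l) -> gcoef a b c = gcoef a' b' c'.
Proof.
have eq_dualp u v P : (forall l, (l < (k + s).-1)%N -> u l = v l) ->
    dualp (k + s).-1 u P = dualp (k + s).-1 v P.
  by move=> uv; apply: eq_bigr => l _; rewrite uv.
move=> aa bb cc.
apply: eq_bigr => Y _; apply: eq_bigr => Z _; rewrite (eq_dualp _ _ _ aa); congr (_ * _).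
apply: eq_bigr => U _; rewrite (eq_dualp _ _ _ bb); congr (_ * _).
by apply: eq_bigr => V _; rewrite (eq_dualp _ _ _ cc).
Qed.

Lemma sum_sgn2_dualp (a : nat -> 'F_2) (Y : {poly_k 'F_2}) :
  \sum_(Z : {poly_s 'F_2}) sgn2 (dualp (k + s).-1 a ((Y : {poly 'F_2}) * Z)) =
  2 ^+ s * (hankel s k a *m (npoly_rV Y)^T == 0)%:R :> R.
Proof.
under eq_bigr do rewrite dualpM.
rewrite (sum_npoly_sgn2 R s (fun j => \sum_(i < k) a (j + i)%N * Y`_i)).
congr (_ * (nat_of_bool _)%:R); apply/forallP/eqP => [H|/colP H j].
  apply/colP => j; rewrite !mxE -[RHS](eqP (H j)).
  by apply: eq_bigr => i _; rewrite !mxE.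
have := H j; rewrite !mxE => Hj; apply/eqP; rewrite -[RHS]Hj.
by apply: eq_bigr => i _; rewrite !mxE.
Qed.

Lemma gcoef_rank (a b c : nat -> 'F_2) :
  gcoef a b c = 2 ^+ (3 * s + (k - \rank (hankel3 s k a b c))).
Proof.
(* The right side also becomes a sum over Y: the second power of 2 counts the Y killed by the
   stacked matrix. *)
rewrite exprD -[2 ^+ (k - _)]natrX -card_npoly_kernel -sum1_card natr_sum mulr_sumr [RHS]big_mkcond.
apply: eq_bigr => Y _; rewrite -mulr_suml sum_sgn2_dualp -mulr_suml !sum_sgn2_dualp.
rewrite /= inE /hankel3 !mul_col_mx !col_mx_eq0.
case: (_ == 0); case: (_ == 0); case: (_ == 0) => /=; rewrite ?(mulr0, mul0r) //.
by rewrite !mulr1 mulnC exprM; ring.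
Qed.

End gcoef.

Lemma sum_triple (R : comPzRingType) (A : finType) (f g h : A -> R) :
  \sum_(x : A * A * A) f x.1.1 * g x.1.2 * h x.2 =
  (\sum_x f x) * (\sum_x g x) * (\sum_x h x).
Proof.
rewrite -(pair_bigA _ (fun x z => f x.1 * g x.2 * h z)) /=.
under eq_bigr do rewrite -mulr_sumr.
rewrite -mulr_suml -(pair_bigA _ (fun x y => f x * g y)) /=.
by under eq_bigr do rewrite -mulr_sumr; rewrite -mulr_suml.
Qed.

(** * Power sums of g and the number of solutions *)

Section count.
Variables (R : realType) (k s : nat).
Local Notation N := (k + s).-1.
Local Notation A := {poly_N 'F_2}.
Local Notation quad := ({poly_k 'F_2} * {poly_s 'F_2} * {poly_s 'F_2} * {poly_s 'F_2})%type.

(** The pairing is symmetric in the coefficients of a and P, so the sum over Z applies with the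
    roles exchanged; by the size bound, N zero coefficients force P = 0. *)
Lemma sum_sgn2_dualp_orth (P : {poly 'F_2}) : (size P <= N)%N ->
  \sum_(a : A) sgn2 (dualp N (nth 0 a) P) = 2 ^+ N * (P == 0)%:R :> R.
Proof.
move=> sP; under eq_bigr => a _.
  rewrite /dualp; under eq_bigr do rewrite mulrC.
  over.
rewrite (sum_npoly_sgn2 R N (fun l => P`_l)); congr (_ * (nat_of_bool _)%:R).
apply/forallP/eqP => [P0|-> l]; last by rewrite coef0.
apply/polyP => i; rewrite coef0; have [iN|Ni] := ltnP i N.
  by rewrite (eqP (P0 (Ordinal iN))).
by rewrite nth_default // (leq_trans sP).
Qed.

(** A single sum over quadruples, ready for expanding its q-th power. *)
Lemma gcoef_quad (a b c : nat -> 'F_2) :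
  gcoef R k s a b c = \sum_(x : quad)
    sgn2 (dualp N a ((x.1.1.1 : {poly 'F_2}) * x.1.1.2)) *
    sgn2 (dualp N b ((x.1.1.1 : {poly 'F_2}) * x.1.2)) *
    sgn2 (dualp N c ((x.1.1.1 : {poly 'F_2}) * x.2)).
Proof.
rewrite -(pair_bigA _ (fun (x : {poly_k 'F_2} * {poly_s 'F_2} * {poly_s 'F_2})
  (V : {poly_s 'F_2}) => sgn2 (dualp N a ((x.1.1 : {poly 'F_2}) * x.1.2)) *
    sgn2 (dualp N b ((x.1.1 : {poly 'F_2}) * x.2)) *
    sgn2 (dualp N c ((x.1.1 : {poly 'F_2}) * V)))) /=.
rewrite -(pair_bigA _ (fun (x : {poly_k 'F_2} * {poly_s 'F_2}) (U : {poly_s 'F_2}) =>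
  \sum_(V : {poly_s 'F_2}) sgn2 (dualp N a ((x.1 : {poly 'F_2}) * x.2)) *
    sgn2 (dualp N b ((x.1 : {poly 'F_2}) * U)) *
    sgn2 (dualp N c ((x.1 : {poly 'F_2}) * V)))) /=.
rewrite -(pair_bigA _ (fun (Y : {poly_k 'F_2}) (Z : {poly_s 'F_2}) =>
  \sum_(U : {poly_s 'F_2}) \sum_(V : {poly_s 'F_2}) sgn2 (dualp N a ((Y : {poly 'F_2}) * Z)) *
    sgn2 (dualp N b ((Y : {poly 'F_2}) * U)) *
    sgn2 (dualp N c ((Y : {poly 'F_2}) * V)))) /=.
apply: eq_bigr => Y _; apply: eq_bigr => Z _; rewrite mulr_sumr.
by apply: eq_bigr => U _; rewrite mulrA mulr_sumr.
Qed.

Lemma size_sum_npolyM (q : nat) (Y : 'I_q -> {poly_k 'F_2}) (Z : 'I_q -> {poly_s 'F_2}) :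
  (size (\sum_i (Y i : {poly 'F_2}) * Z i)%R <= N)%N.
Proof.
apply: (leq_trans (size_sum _ _ _)); apply/bigmax_leqP => i _.
apply: (leq_trans (size_polyMleq _ _)).
by have := size_npoly (Y i); have := size_npoly (Z i); lia.
Qed.

(** Expanding the power yields functions into quadruples, not quadruples of functions; [h] is the
    bijection. *)
Lemma num_solutions_ffun (q : nat) :
  num_solutions q k s = #|[pred x : {ffun 'I_q -> quad} |
      [&& \sum_i ((x i).1.1.1 : {poly 'F_2}) * (x i).1.1.2 == 0,
          \sum_i ((x i).1.1.1 : {poly 'F_2}) * (x i).1.2 == 0 &
          \sum_i ((x i).1.1.1 : {poly 'F_2}) * (x i).2 == 0]]|.
Proof.
pose h (x : {ffun 'I_q -> quad}) := ([ffun i => (x i).1.1.1],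
  [ffun i => (x i).1.1.2], [ffun i => (x i).1.2], [ffun i => (x i).2]).
have h_inj : injective h.
  move=> x y [] /ffunP e1 /ffunP e2 /ffunP e3 /ffunP e4; apply/ffunP => i.
  move: (e1 i) (e2 i) (e3 i) (e4 i); rewrite !ffunE.
  by case: (x i) (y i) => [[[? ?] ?] ?] [[[? ?] ?] ?] /= -> -> -> ->.
rewrite -(card_imset _ h_inj); apply: eq_card => -[[[Y Z] U] V].
rewrite inE; apply/idP/imsetP => [H|[x]].
  exists [ffun i => (Y i, Z i, U i, V i)]; last first.
    by congr (_, _, _, _); apply/ffunP => i; rewrite !ffunE.
  rewrite inE; case/and3P: H => /eqP H1 /eqP H2 /eqP H3.
  apply/and3P; split; apply/eqP.
  - by rewrite -[RHS]H1; apply: eq_bigr => i _; rewrite ffunE.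
  - by rewrite -[RHS]H2; apply: eq_bigr => i _; rewrite ffunE.
  - by rewrite -[RHS]H3; apply: eq_bigr => i _; rewrite ffunE.
rewrite inE => /and3P[/eqP H1 /eqP H2 /eqP H3] [-> -> -> ->].
apply/and3P; split; apply/eqP.
- by rewrite -[RHS]H1; apply: eq_bigr => i _; rewrite !ffunE.
- by rewrite -[RHS]H2; apply: eq_bigr => i _; rewrite !ffunE.
- by rewrite -[RHS]H3; apply: eq_bigr => i _; rewrite !ffunE.
Qed.

Lemma sum_gcoef_exp (q : nat) :
  \sum_(x : A * A * A) gcoef R k s (nth 0 x.1.1) (nth 0 x.1.2) (nth 0 x.2) ^+ q =
  2 ^+ (3 * N) * (num_solutions q k s)%:R.
Proof.
have dualp_sum a (F : 'I_q -> {poly 'F_2}) :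
    \prod_(i < q) sgn2 (dualp N a (F i)) = sgn2 (dualp N a (\sum_(i < q) F i)) :> R.
  by rewrite (big_morph _ (dualpD N a) (dualp0 N a)) sgn2_sum.
under eq_bigr => x _.
  (* Writing q as the cardinal of ['I_q] makes the power a product, which distributivity expands
     over functions from ['I_q] to quadruples. *)
  rewrite gcoef_quad -[q in _ ^+ q]card_ord -prodr_const bigA_distr_bigA /=.
  under eq_bigr do rewrite !big_split /= !dualp_sum.
  over.
rewrite /= exchange_big /= num_solutions_ffun -sum1_card natr_sum mulr_sumr [RHS]big_mkcond.
apply: eq_bigr => f _.
rewrite (sum_triple _ _ (fun a : A => sgn2 (dualp N (nth 0 a) _))
  (fun a : A => sgn2 (dualp N (nth 0 a) _)) (fun a : A => sgn2 (dualp N (nth 0 a) _))).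
rewrite !sum_sgn2_dualp_orth; [|exact: size_sum_npolyM..].
rewrite inE /=; case: (_ == 0); case: (_ == 0); case: (_ == 0) => /=; rewrite ?(mulr0, mul0r) //.
by rewrite !mulr1 mulnC exprM; ring.
Qed.

End count.

(** * Persymmetric matrices as Hankel matrices of sequences *)

Lemma persymmetricP (m n : nat) (M : 'M['F_2]_(m, n)) :
  reflect (forall (i : 'I_m) (j : 'I_n) (i' : 'I_m) (j' : 'I_n), (i + j = i' + j')%N -> M i j = M i' j') (persymmetric M).
Proof.
apply: (iffP idP) => [H i j i' j' e|H].
  by move: H => /forallP/(_ i)/forallP/(_ j)/forallP/(_ i')/forallP/(_ j');
    rewrite e eqxx => /eqP.
by do 4!apply/forallP => ?; apply/implyP => /eqP e; apply/eqP/H.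
Qed.

Lemma persymmetric_hankel (s k : nat) (a : nat -> 'F_2) : persymmetric (hankel s k a).
Proof. by apply/persymmetricP => i j i' j' e; rewrite !mxE e. Qed.

(* Inverse of [hankel] on persymmetric matrices: the entry number [l] is read off the
   antidiagonal [i + j = l], at row [min (l, s)], the last row being number [s]. *)
Definition antidiag (s k : nat) (M : 'M['F_2]_(s.+1, k.+1)) :
    {poly_(k.+1 + s.+1).-1 'F_2} :=
  npolyp _ (\poly_(l < (k.+1 + s.+1).-1) M (inord (minn l s)) (inord (l - minn l s))).

Lemma antidiagE (s k : nat) (M : 'M['F_2]_(s.+1, k.+1)) l :
  (l < (k.+1 + s.+1).-1)%N ->
  (antidiag s k M)`_l = M (inord (minn l s)) (inord (l - minn l s)).
Proof. by move=> lN; rewrite coef_npolyp lN coef_poly lN. Qed.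

Lemma hankel_antidiag (s k : nat) (M : 'M['F_2]_(s.+1, k.+1)) :
  persymmetric M -> hankel s.+1 k.+1 (nth 0 (antidiag s k M)) = M.
Proof.
move=> /persymmetricP pM; apply/matrixP => i j; rewrite mxE.
have [si sj] := (ltn_ord i, ltn_ord j).
(* The entry read off lies on the antidiagonal of (i, j), and i + j <= k + s keeps its column at
   most k, so [inord] does not default. *)
by rewrite antidiagE; [apply: pM; rewrite !inordK|]; lia.
Qed.

Lemma antidiag_hankel (s k : nat) (a : {poly_(k.+1 + s.+1).-1 'F_2}) :
  antidiag s k (hankel s.+1 k.+1 (nth 0 a)) = a.
Proof.
apply/npolyP => l; have [lN|Nl] := ltnP l (k.+1 + s.+1).-1; last first.
  by rewrite !big_coef_npoly.
by rewrite antidiagE // mxE !inordK; [congr nth| |]; lia.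
Qed.

(** For positive k and s all k + s - 1 antidiagonals are nonempty, so triples of sequences
    correspond to the matrices counted by [Gamma], which are then sorted by rank. *)
Lemma sum_rank_hankel3 (R : realType) (k s : nat) (f : nat -> R) :
  (0 < k)%N -> (0 < s)%N ->
  \sum_(x : {poly_(k + s).-1 'F_2} * {poly_(k + s).-1 'F_2} * {poly_(k + s).-1 'F_2})
     f (\rank (hankel3 s k (nth 0 x.1.1) (nth 0 x.1.2) (nth 0 x.2))) =
  \sum_(0 <= i < (minn (3 * s) k).+1) (Gamma s k i)%:R * f i.
Proof.
case: k s => [//|k] [//|s] _ _.
pose S := s.+1; pose K := k.+1.
pose pers (M : 'M['F_2]_(S + (S + S), K)) :=
  [&& persymmetric (usubmx M), persymmetric (usubmx (dsubmx M)) &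
      persymmetric (dsubmx (dsubmx M))].
pose h (x : {poly_(K + S).-1 'F_2} * {poly_(K + S).-1 'F_2} * {poly_(K + S).-1 'F_2}) :=
  hankel3 S K (nth 0 x.1.1) (nth 0 x.1.2) (nth 0 x.2).
pose h' (M : 'M['F_2]_(S + (S + S), K)) := (antidiag s k (usubmx M),
  antidiag s k (usubmx (dsubmx M)), antidiag s k (dsubmx (dsubmx M))).
transitivity (\sum_(M | pers M) f (\rank M)).
  rewrite (reindex_onto h h') => [|M /and3P[p1 p2 p3]]; last first.
    by rewrite /h /h' /hankel3 /= !hankel_antidiag // !vsubmxK.
  apply: eq_big => // -[[a b] c]; rewrite /pers /h /h' /hankel3 /=.
  by rewrite !(col_mxKu, col_mxKd) !persymmetric_hankel /= !antidiag_hankel eqxx.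
(* With this bound [inord] is faithful on ranks. *)
have rank_lt (M : 'M['F_2]_(S + (S + S), K)) : (\rank M < (minn (3 * S) K).+1)%N.
  by have := rank_leq_row M; have := rank_leq_col M; lia.
rewrite big_mkord.
rewrite (partition_big (fun M => inord (\rank M) : 'I_(minn (3 * S) K).+1) predT) //=.
apply: eq_bigr => i _; rewrite /Gamma -sum1_card natr_sum mulr_suml.
apply: eq_big => [M|M /andP[_ /eqP <-]]; last by rewrite inordK // mul1r.
by rewrite inE /pers -val_eqE /= inordK // -!andbA.
Qed.

(** * Step functions and the Haar measure of cylinders *)

Lemma integral_step (d : measure_display) (T : measurableType d) (R : realType)
    (mu : {measure set T -> \bar R}) (I : finType) (F : I -> set T) (f : T -> R)
    (c : I -> R) :
  (forall i, measurable (F i)) -> trivIset setT F ->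
  (forall i x, F i x -> f x = c i) ->
  (\int[mu]_(x in \bigcup_i F i) (f x)%:E = \sum_i (c i)%:E * mu (F i))%E.
Proof.
move=> mF tF fc.
have setTE : [set: I] = [set` enum I].
  by apply/seteqP; split => i //= _; rewrite mem_enum.
rewrite setTE bigcup_seq integral_bigsetU_EFin ?enum_uniq //.
- rewrite big_enum /=; apply: eq_bigr => i _; rewrite -integral_cst //.
  by apply: eq_integral => x; rewrite inE => /fc->.
- by rewrite -setTE.
(* Measurability of f on the union comes from its constancy on each piece, by induction on the
   enumeration. *)
- have mEF r : measurable (\big[setU/set0]_(i <- r) F i) by exact: bigsetU_measurable.
  elim: (enum I) => [|i r IHr]; first by rewrite big_nil; exact: measurable_fun_set0.
  rewrite big_cons; apply/measurable_funU => //; split; last exact: IHr.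
  apply/measurable_EFinP; apply: (eq_measurable_fun (cst (c i))) => [x|].
    by rewrite inE => /fc.
  exact: measurable_cst.
Qed.

(** A closed ball of radius 2^(-1-N), indexed by the N coefficients that its points share. *)
Definition cyl (N : nat) (a : {poly_N 'F_2}) : set laurent :=
  [set t | unit_itv t /\ forall l, (l < N)%N -> neg_coef t l = a`_l].

Lemma addlE (x y : laurent) i : (x + y) i = x i + y i. Proof. by []. Qed.
Lemma opplE (x : laurent) i : (- x) i = - x i. Proof. by []. Qed.

Fact laurent_of_neg_coef_subproof (a : {poly 'F_2}) :
  exists n, deg_le (fun i => if i is Negz l then a`_l else 0) n.
Proof. by exists (-1) => -[l|l] //; lia. Qed.
(** [Negz l] is -1 - l, so [neg_coef] recovers the coefficients of a. *)
Definition laurent_of_neg_coef a := Laurent (laurent_of_neg_coef_subproof a).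

Section cylinder.
Variable N : nat.

Lemma measurable_cyl (a : {poly_N 'F_2}) : measurable (cyl N a).
Proof.
suff : laurent_open (cyl N a) by exact: sub_sigma_algebra.
(* The N prescribed coefficients have exponents -1 to -N, all above -1 - N. *)
move=> t [t1 ta]; exists (-1 - N%:Z) => u ut.
have utE i : -1 - N%:Z < i -> u i = t i.
  by move=> /ut /eqP; rewrite addlE opplE subr_eq0 => /eqP.
split=> [i i0|l lN]; first by rewrite utE ?t1 //; lia.
by rewrite -ta // /neg_coef utE //; lia.
Qed.

Lemma bigcup_cyl : \bigcup_a cyl N a = unit_itv.
Proof.
apply/seteqP; split=> [t [a _ []]//|t t1].
exists (npolyp N (\poly_(l < N) neg_coef t l)) => //; split=> // l lN.
by rewrite coef_npolyp lN coef_poly lN.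
Qed.

Lemma trivIset_cyl : trivIset setT (cyl N).
Proof.
move=> a b _ _ [t [[_ ta] [_ tb]]]; apply/npolyP => l.
by have [lN|Nl] := ltnP l N; [rewrite -ta // -tb|rewrite !big_coef_npoly].
Qed.

Lemma cyl_translate (a : {poly_N 'F_2}) :
  cyl N a = (fun t => laurent_of_neg_coef a + t) @` cyl N 0.
Proof.
have wE l : neg_coef (laurent_of_neg_coef a) l = a`_l.
  by rewrite /neg_coef /=; have -> : -1 - l%:Z = Negz l by lia.
have w1 : unit_itv (laurent_of_neg_coef a) by move=> [l|l] //; lia.
apply/seteqP; split=> [t [t1 ta]|_ [t [t1 t0] <-]].
  exists (t - laurent_of_neg_coef a); last by rewrite addrC subrK.
  split=> [i i0|l lN]; first by rewrite addlE opplE t1 // w1 // subr0.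
  by have := ta l lN; rewrite -wE coef0 /neg_coef addlE opplE => ->; rewrite subrr.
split=> [i i0|l lN]; first by rewrite addlE t1 // w1 // addr0.
by have := t0 l lN; rewrite -wE coef0 /neg_coef addlE => ->; rewrite addr0.
Qed.

(** The 2^N cylinders are translates of one another and partition the unit interval, of measure
    1. *)
Lemma haar_cyl (R : realType) (mu : {measure set laurent -> \bar R})
    (a : {poly_N 'F_2}) : normalized_haar mu -> mu (cyl N a) = (2 ^- N)%:E.
Proof.
move=> [muD mu1].
have mua b : mu (cyl N b) = mu (cyl N 0).
  by rewrite cyl_translate muD //; exact: measurable_cyl.
have m0 : measurable (cyl N 0) := measurable_cyl 0.
have munit : measurable unit_itv.
  rewrite -bigcup_cyl; apply: fin_bigcup_measurable => [|b _].
    exact: finite_finset.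
  exact: measurable_cyl.
have mu0_fin : mu (cyl N 0) \is a fin_num.
  rewrite ge0_fin_numE // (@le_lt_trans _ _ (mu unit_itv)) ?mu1 ?ltry //.
  by rewrite -mu1 le_measure ?inE // => t [].
(* Integrating 1 over the partition gives 1 as the sum of the measures. *)
have := integral_step _ _ _ mu _ (cyl N) (cst 1) (cst 1) measurable_cyl trivIset_cyl
  (fun _ _ _ => erefl).
rewrite bigcup_cyl (integral_cst mu munit 1%E) mul1e mu1 mua => /esym.
under eq_bigr do rewrite mul1e mua -(fineK mu0_fin).
rewrite -(fineK mu0_fin) sumEFin sumr_const card_npoly card_Fp // => -[e].
congr EFin; apply: (mulIf (_ : 2 ^+ N != 0)); first by rewrite expf_neq0 // pnatr_eq0.
by rewrite mulVf ?expf_neq0 ?pnatr_eq0 // -[RHS]e -[RHS]mulr_natr natrX.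
Qed.
End cylinder.

(** * The integral of g^q and the two equalities *)

Lemma integral_g (R : realType) (mu : {sigma_finite_measure set laurent -> \bar R})
    (k s q : nat) : normalized_haar mu ->
  (\int[mu \x mu \x mu]_(x in unit_itv `*` unit_itv `*` unit_itv)
       ((g R k s x.1.1 x.1.2 x.2) ^+ q)%:E =
   (2 ^- (3 * (k + s).-1) *
    \sum_(x : {poly_(k + s).-1 'F_2} * {poly_(k + s).-1 'F_2} * {poly_(k + s).-1 'F_2})
      gcoef R k s (nth 0 x.1.1) (nth 0 x.1.2) (nth 0 x.2) ^+ q)%R%:E)%E.
Proof.
move=> hmu; set N := (k + s).-1.
pose F (x : {poly_N 'F_2} * {poly_N 'F_2} * {poly_N 'F_2}) :=
  cyl N x.1.1 `*` cyl N x.1.2 `*` cyl N x.2.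
have mcyl := measurable_cyl N.
(* The boxes [F x] partition the unit cube. *)
have -> : unit_itv `*` unit_itv `*` unit_itv = \bigcup_x F x.
  rewrite -(bigcup_cyl N); apply/seteqP; split.
    move=> [[t u] v] [[[a _ ta] [b _ tb]] [c _ tc]].
    by exists (a, b, c).
  move=> [[t u] v] [[[a b] c] _ [[ta ub] vc]].
  by split; [split; [exists a|exists b]|exists c].
rewrite (integral_step _ _ _ _ _ F _
  (fun x => gcoef R k s (nth 0 x.1.1) (nth 0 x.1.2) (nth 0 x.2) ^+ q)).
- rewrite mulr_sumr -sumEFin; apply: eq_bigr => x _.
  have mu2 : ((mu \x mu) (cyl N x.1.1 `*` cyl N x.1.2) = (2 ^- N * 2 ^- N)%:E)%E.
    by rewrite product_measure1E // !haar_cyl // EFinM.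
  have N3 : 2 ^- (3 * N) = 2 ^- N * 2 ^- N * 2 ^- N :> R.
    by rewrite mulnC exprM -exprVn; ring.
  rewrite [in RHS]mulrC N3 EFinM; congr mule.
  etransitivity; first by apply: product_measure1E => //; exact: measurableX.
  by rewrite EFinM; congr mule; [exact: mu2|exact: haar_cyl].
- by move=> x; apply: measurableX => //; exact: measurableX.
- move=> [[a b] c] [[a' b'] c'] _ _ [[[t u] v] [[[ta ub] vc] [[ta' ub'] vc']]].
  congr (_, _, _); apply: (trivIset_cyl N) => //.
  + by exists t.
  + by exists u.
  + by exists v.
- move=> [[a b] c] [[t u] v] /= [[[_ ta] [_ ub]] [_ vc]].
  by rewrite g_gcoef; congr (_ ^+ q); apply: eq_gcoef.
Qed.

Theorem theorem3p4 (R : realType) (mu : {sigma_finite_measure set laurent -> \bar R})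
    (k s q : nat) :
  normalized_haar mu -> (0 < k)%N -> (0 < s)%N -> (0 < q)%N ->
  ((num_solutions q k s)%:R%:E =
     \int[mu \x mu \x mu]_(x in unit_itv `*` unit_itv `*` unit_itv)
       ((g R k s x.1.1 x.1.2 x.2) ^+ q)%:E)%E /\
  (\int[mu \x mu \x mu]_(x in unit_itv `*` unit_itv `*` unit_itv)
       ((g R k s x.1.1 x.1.2 x.2) ^+ q)%:E =
    (2 ^+ ((3 * s + k) * q) * 2 ^ (- 3 * k%:Z - 3 * s%:Z + 3) *
     (\sum_(0 <= i < (minn (3 * s) k).+1) (Gamma s k i)%:R * 2 ^- (q * i)))%:E)%E.
Proof.
move=> hmu k0 s0 q0; rewrite integral_g //; split.
  by rewrite sum_gcoef_exp mulKf // expf_neq0 // pnatr_eq0.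
congr EFin; rewrite -sum_rank_hankel3 // !mulr_sumr; apply: eq_bigr => x _.
rewrite gcoef_rank; set M := hankel3 _ _ _ _ _; have rk := rank_leq_col M.
have two0 : (2 : R) != 0 by rewrite pnatr_eq0.
(* With r the rank, the integer exponents to compare are (3s + k - r)q - 3(k + s - 1) and (3s + k)q
   - 3k - 3s + 3 - qr; r <= k and k, s > 0 make the natural subtractions exact. *)
rewrite -exprM !exprnN !exprnP -!expfzDr //; congr (_ ^ _).
nia.
Qed.
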